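(* Let $\underline{A},\overline{A}\in\mathbb{R}^{n\times n}$ with $\underline{A}\le\overline{A}$ (entrywise) and let $\mathbf{A}=\{A\in\mathbb{R}^{n\times n} : \underline{A}\le A\le\overline{A}\}$. Then $\mathbf{A}$ is strongly an $R$-matrix if and only if for each index set $\emptyset\ne I\subseteq\{1,\dots,n\}$, with $J:=\{1,\dots,n\}\setminus I$, the system $$\underline{A}_{I,I}x+et\le0,\quad \overline{A}_{I,I}x+et\ge0,\quad \overline{A}_{J,I}x+et\ge0,\quad x>0,\ t\ge0$$ in variables $x\in\mathbb{R}^{|I|}$, $t\in\mathbb{R}$ is infeasible.
   Context: All inequalities between vectors or matrices are entrywise; $e=(1,\dots,1)^T$ is the all-ones vector of the appropriate dimension. A matrix property holds strongly for an interval matrix $\mathbf{A}$ if it holds for every $A\in\mathbf{A}$. For index sets $I,J$, $A_{I,J}$ is the submatrix of $A$ with rows indexed by $I$ and columns indexed by $J$. A matrix $A\in\mathbb{R}^{n\times n}$ is an $R$-matrix (regular) if for each $\emptyset\ne I\subseteq\{1,\dots,n\}$, with $J:=\{1,\dots,n\}\setminus I$, the system $A_{I,I}x+et=0$, $A_{J,I}x+et\ge0$, $x>0$, $t\ge0$ in variables $x\in\mathbb{R}^{|I|}$, $t\in\mathbb{R}$ is infeasible. *)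

(* Defs.v *)
From mathcomp Require Import all_boot all_order all_algebra.
From mathcomp Require Import reals.

Set Implicit Arguments.
Unset Strict Implicit.
Unset Printing Implicit Defensive.

Import Order.TTheory GRing.Theory Num.Theory.
Local Open Scope ring_scope.

Definition mxle (R : realType) (m n : nat) (A B : 'M[R]_(m, n)) : Prop :=
  forall i j, A i j <= B i j.

Definition mxlt (R : realType) (m n : nat) (A B : 'M[R]_(m, n)) : Prop :=
  forall i j, A i j < B i j.

Notation "A <=m B" := (mxle A B) (at level 70, no associativity) : ring_scope.
Notation "A <m B" := (mxlt A B) (at level 70, no associativity) : ring_scope.

(* A_{I,J}. The k-th row (resp. column) is the one whose index is the k-th
   smallest element of I (resp. J). *)
Definition subix (R : realType) (n : nat) (I J : {set 'I_n}) (A : 'M[R]_n) :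
    'M[R]_(#|I|, #|J|) :=
  mxsub (fun i : 'I_#|I| => enum_val i) (fun j : 'I_#|J| => enum_val j) A.

Definition ones (R : realType) (m : nat) : 'cV[R]_m := const_mx 1.
Arguments ones {R m}.

Definition R_matrix (R : realType) (n : nat) (A : 'M[R]_n) : Prop :=
  forall I : {set 'I_n}, I != set0 ->
    let J := ~: I in
    ~ exists (x : 'cV[R]_#|I|) (t : R),
      [/\ subix I I A *m x + t *: ones = 0,
          0 <=m subix J I A *m x + t *: ones,
          0 <m x
        & 0 <= t].

Definition interval_matrix (R : realType) (m n : nat) (Al Au : 'M[R]_(m, n)) :
    'M[R]_(m, n) -> Prop :=
  fun A => Al <=m A /\ A <=m Au.

Definition strongly (R : realType) (m n : nat) (P : 'M[R]_(m, n) -> Prop)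
    (AA : 'M[R]_(m, n) -> Prop) : Prop :=
  forall A, AA A -> P A.

(* Main.v *)
(* Fix I and a solution (x, t) of the interval system.  For each row i in I,
   the affine form A_i x + t is nonpositive at the lower row and nonnegative at
   the upper row, so it vanishes at some convex combination of the two; choosing
   these rows for i in I and the upper rows elsewhere produces a matrix of the
   interval for which (x, t) witnesses that it is not an R-matrix.  Conversely,
   since x > 0, the forms are monotone in A, so a witness for some A in the
   interval solves the interval system. *)
Require Import Defs.
From mathcomp Require Import all_boot all_order all_algebra.
From mathcomp Require Import reals.
From mathcomp Require Import ring lra.

Set Implicit Arguments.
Unset Strict Implicit.
Unset Printing Implicit Defensive.

Import Order.TTheory GRing.Theory Num.Theory.
Local Open Scope ring_scope.

(** Rows are indexed by ['I_n] rather than by position in a subset, so that one function serves both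
    the rows in [I] and those in its complement. *)
Definition row_form (R : realType) (n : nat) (A : 'M[R]_n) (I : {set 'I_n})
    (x : 'cV[R]_#|I|) (t : R) (i : 'I_n) : R :=
  \sum_k A i (enum_val k) * x k 0 + t.

Lemma subix_mulmxE (R : realType) (n : nat) (A : 'M[R]_n) (I K : {set 'I_n})
    (x : 'cV[R]_#|I|) (t : R) (k : 'I_#|K|) (j : 'I_1) :
  (subix K I A *m x + t *: ones) k j = row_form A x t (enum_val k).
Proof.
rewrite (ord1 j) !mxE mulr1; congr (_ + _).
by apply: eq_bigr => l _; rewrite mxE.
Qed.

Lemma row_form_le (R : realType) (n : nat) (A B : 'M[R]_n) (I : {set 'I_n})
    (x : 'cV[R]_#|I|) (t : R) (i : 'I_n) :
  0 <m x -> A <=m B -> row_form A x t i <= row_form B x t i.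
Proof.
move=> x_gt0 leAB; rewrite lerD2r; apply: ler_sum => k _.
by apply: ler_wpM2r (leAB _ _); have := x_gt0 k 0; rewrite mxE => /ltW.
Qed.

(** The coefficient depends on the row alone, so it factors out of the sum over columns and
    [row_form] is interpolated with the same [c i]. *)
Definition row_interp (R : realType) (n : nat) (A B : 'M[R]_n)
    (c : 'I_n -> R) : 'M[R]_n :=
  \matrix_(i, j) (A i j + c i * (B i j - A i j)).

Lemma row_form_interp (R : realType) (n : nat) (A B : 'M[R]_n) (c : 'I_n -> R)
    (I : {set 'I_n}) (x : 'cV[R]_#|I|) (t : R) (i : 'I_n) :
  row_form (row_interp A B c) x t i
    = row_form A x t i + c i * (row_form B x t i - row_form A x t i).
Proof.
rewrite /row_form opprD addrACA subrr addr0 -sumrB mulr_sumr addrAC.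
rewrite -big_split /=; congr (_ + _).
by apply: eq_bigr => k _; rewrite mxE; ring.
Qed.

Lemma row_interp_in_interval (R : realType) (n : nat) (A B : 'M[R]_n)
    (c : 'I_n -> R) :
  A <=m B -> (forall i, 0 <= c i <= 1) ->
  interval_matrix A B (row_interp A B c).
Proof.
move=> leAB c01; split=> i j; rewrite mxE;
  have /andP[c0 c1] := c01 i; have := leAB i j; nra.
Qed.

(* When [a = b = 0] the quotient is the junk value [0 / 0 = 0], which works. *)
Lemma interp_root (R : realFieldType) (a b : R) : a <= 0 -> 0 <= b ->
  0 <= - a / (b - a) <= 1 /\ a + - a / (b - a) * (b - a) = 0.
Proof.
move=> a_le0 b_ge0; have [ab0|ab_neq0] := eqVneq (b - a) 0.
  by rewrite ab0 invr0 !mulr0 lexx ler01; split=> //; lra.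
have ab_gt0 : 0 < b - a by rewrite lt0r ab_neq0; lra.
rewrite divfK // subrr ler_pdivrMr // mul1r divr_ge0 ?(ltW ab_gt0) //; last lra.
by split=> //=; lra.
Qed.

Theorem proposition16 (R : realType) (n : nat) (Al Au : 'M[R]_n)
    (hA : Al <=m Au) :
  strongly (@R_matrix R n) (interval_matrix Al Au) <->
  (forall I : {set 'I_n}, I != set0 ->
    let J := ~: I in
    ~ exists (x : 'cV[R]_#|I|) (t : R),
      [/\ subix I I Al *m x + t *: ones <=m 0,
          0 <=m subix I I Au *m x + t *: ones,
          0 <=m subix J I Au *m x + t *: ones,
          0 <m x
        & 0 <= t]).
Proof.
split=> [regA I I0 J [x [t [Al_le0 Au_ge0 AuJ_ge0 x_gt0 t_ge0]]]|
         infeas A [leAlA leAAu] I I0 J [x [t [A0 AJ_ge0 x_gt0 t_ge0]]]].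
- pose lo := row_form Al x t; pose up := row_form Au x t.
  have root i : i \in I -> 0 <= - lo i / (up i - lo i) <= 1 /\
      lo i + - lo i / (up i - lo i) * (up i - lo i) = 0.
    move=> iI; apply: interp_root.
      (* The inequalities of the system are indexed by positions in [I]; [enum_rank_in] gives the
         position of [i]. *)
      have := Al_le0 (enum_rank_in iI i) 0.
      by rewrite subix_mulmxE enum_rankK_in // mxE.
    have := Au_ge0 (enum_rank_in iI i) 0.
    by rewrite subix_mulmxE enum_rankK_in // mxE.
  (* The value 1 selects the row of [Au], where [AuJ_ge0] applies. *)
  pose c i := if i \in I then - lo i / (up i - lo i) else 1.
  have c01 i : 0 <= c i <= 1.
    by rewrite /c; case: ifP => [/root[]//|_]; rewrite ler01 lexx.
  apply: (regA _ (row_interp_in_interval hA c01) I I0).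
  exists x, t; split=> //.
    apply/matrixP=> k j; rewrite subix_mulmxE row_form_interp mxE.
    by rewrite /c enum_valP; case: (root _ (enum_valP k)).
  move=> k j; have := AuJ_ge0 k j; rewrite !subix_mulmxE row_form_interp.
  have /negbTE kI : enum_val k \notin I by have := enum_valP k; rewrite inE.
  by rewrite /c kI mul1r subrKC.
- apply: (infeas I I0); exists x, t; split=> // k j.
  (* On [I] the form of [A] is zero, so replacing 0 by it reduces both bounds to monotonicity in the
     matrix. *)
  + rewrite -A0 !subix_mulmxE; exact: row_form_le.
  + rewrite -A0 !subix_mulmxE; exact: row_form_le.
  + apply: le_trans (AJ_ge0 k j) _; rewrite !subix_mulmxE; exact: row_form_le.
Qed.
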